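(* Let $\mathcal H$ be a separable complex Hilbert space and let $w\colon\mathbb N_0\to\mathbb R_{>0}$ be a weight with $w(0)=1$ that is inverse square-summable, $w^{-1}\in\ell^2(\mathbb N)$. Let $F_w^\otimes(\mathcal H)$ be the weighted full Fock space of $\mathcal H$, and let $\boxtimes$ denote the Hilbert space tensor product. Then there exists a unique bounded operator $\Delta\colon F_w^\otimes(\mathcal H)\to F_w^\otimes(\mathcal H)\boxtimes F_w^\otimes(\mathcal H)$ such that $\Delta^*(f\boxtimes g)=f\otimes g$ if and only if $w^{-2}$ is subconvolutive, i.e. there is a constant $C$ with $(w^{-2}*w^{-2})(n)\le C\,w^{-2}(n)$ for all $n\in\mathbb N_0$.
   Context: $F_w^\otimes(\mathcal H)$ is the Hilbert space completion of the tensor algebra $T(\mathcal H)=\mathbb C\oplus\mathcal H\oplus\mathcal H^{\otimes2}\oplus\cdots$ with respect to the inner product for which different degrees are orthogonal, $\langle a,b\rangle=\bar ab$ for $a,b\in\mathbb C$, and $\langle f_1\otimes\cdots\otimes f_n,g_1\otimes\cdots\otimes g_n\rangle_{F_w^\otimes(\mathcal H)}=w^2(n)\prod_{i=1}^n\langle f_i,g_i\rangle_{\mathcal H}$ for $f_i,g_i\in\mathcal H$. The symbol $\otimes$ denotes the product inside the Fock space: the product of the tensor algebra, so that for $f=\sum_n f_n$ and $g=\sum_n g_n$ with $f_n,g_n$ of degree $n$, the degree-$n$ component of $f\otimes g$ is $\sum_{k=0}^n f_k\otimes g_{n-k}$. The symbol $\boxtimes$ is used for the usual tensor product of two Hilbert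 spaces, to distinguish it from $\otimes$. The identity $\Delta^*(f\boxtimes g)=f\otimes g$ is understood for $f,g\in F_w^\otimes(\mathcal H)$. Convolution on $\mathbb N_0$: $(u*v)(n)=\sum_{a+b=n}u(a)v(b)$; $w^{-1}(n)=1/w(n)$ and $w^{-2}(n)=1/w(n)^2$.
   Formalization: The Hilbert space is assumed nonzero: for the zero space the Fock space is C and the operator always exists uniquely, yet for w(n)^2 = exp(n^2) the function w^{-2} is not subconvolutive, so the equivalence fails there. *)

(* Defs.v *)
(* The complex numbers are R[i] for R : realType. *)
From HB Require Import structures.
From mathcomp Require Export all_boot all_order all_algebra.
From mathcomp Require Export complex.
From mathcomp Require Export all_classical all_reals all_analysis.
Set Implicit Arguments.
Unset Strict Implicit.
Unset Printing Implicit Defensive.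
Import Order.TTheory GRing.Theory Num.Theory.
Import numFieldNormedType.Exports.
Local Open Scope classical_set_scope.
Local Open Scope ring_scope.
Local Open Scope complex_scope.

HB.mixin Record isHilbert (R : realType) H of CompleteNormedModule R[i] H := {
  hdot : {dot H for (Num.conj : R[i] -> R[i])};
  sqr_norm_hdot : forall x : H, `|x| ^+ 2 = hdot x x
}.

#[short(type="hilbertType")]
HB.structure Definition Hilbert (R : realType) :=
  {H of isHilbert R H & CompleteNormedModule R[i] H}.

(* A form of type {dot _ for _} is linear on the left; the inner product used
   here is linear on the right and conjugate-linear on the left. *)
Definition inner (R : realType) (H : hilbertType R) (x y : H) : R[i] :=
  (hdot : {dot H for Num.conj}) y x.

Definition separable_space (T : topologicalType) : Prop :=
  exists2 S : set T, countable S & dense S.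

Definition bounded_operator (R : realType) (H K : hilbertType R)
    (D : H -> K) : Prop :=
  linear D /\ exists M : R, forall x, `|D x| <= M%:C * `|x|.

Definition is_adjoint (R : realType) (H K : hilbertType R)
    (D : H -> K) (Dstar : K -> H) : Prop :=
  forall x y, inner (Dstar y) x = inner y (D x).

(* The Hilbert tensor product is determined up to a unique unitary compatible
   with the elementary tensors by the following data; the record packages an
   arbitrary choice of it. *)
Record hilbertTensor (R : realType) (H K : hilbertType R) := HilbertTensor {
  tensor_space :> hilbertType R;
  boxt : H -> K -> tensor_space;
  boxt_linearl : forall y, linear (fun x => boxt x y);
  boxt_linearr : forall x, linear (boxt x);
  inner_boxt : forall x1 y1 x2 y2,
    inner (boxt x1 y1) (boxt x2 y2) = inner x1 x2 * inner y1 y2;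
  boxt_total :
    dense (range (fun a : seq (H * K) => \sum_(p <- a) boxt p.1 p.2))
}.

Notation "f ⊠ g" := (boxt _ f g) (at level 40, left associativity).

(* The formal linear combination of words [:: (c_1, s_1); ...; (c_m, s_m)]
   represents the element c_1 s_1 + ... + c_m s_m of the tensor algebra of H,
   where the word [:: f_1; ...; f_n] stands for the elementary tensor
   f_1 ⊗ ... ⊗ f_n and the empty word for the unit 1. *)
Definition formal_tensor (R : realType) (H : hilbertType R) :=
  seq (R[i] * seq H).

Definition homogeneous_formal (R : realType) (H : hilbertType R) (n : nat)
    (a : formal_tensor H) : bool :=
  all (fun p => size p.2 == n) a.

Definition formal_mul (R : realType) (H : hilbertType R)
    (a b : formal_tensor H) : formal_tensor H :=
  [seq (p.1 * q.1, p.2 ++ q.2) | p <- a, q <- b].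

Definition formal_eval (R : realType) (H F : hilbertType R)
    (el : seq H -> F) (a : formal_tensor H) : F :=
  \sum_(p <- a) p.1 *: el p.2.

(* The weighted full Fock space, again determined up to a unique unitary
   compatible with the elementary tensors. The inner product prescribed on
   elementary tensors is definite on the tensor algebra of H, which is thus
   identified with its image, the dense span of the elementary tensors. *)
Record fullFock (R : realType) (H : hilbertType R) (w : nat -> R) :=
  FullFock {
  fock_space :> hilbertType R;
  elem : seq H -> fock_space;
  elem_linear : forall s t, linear (fun x => elem (s ++ x :: t));
  inner_elem : forall s t, inner (elem s) (elem t) =
    if size s == size t
    then (w (size s) ^+ 2)%:C * \prod_(p <- zip s t) inner p.1 p.2
    else 0;
  elem_total : dense (range (formal_eval elem))
}.

Section FockProduct.
Variables (R : realType) (H : hilbertType R) (w : nat -> R).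
Variable (F : fullFock H w).

Definition fock_eval (a : formal_tensor H) : F := formal_eval (@elem _ _ _ F) a.

(* The elements of degree n: the closure of the n-th algebraic tensor power. *)
Definition homogeneous (n : nat) : set F :=
  closure (fock_eval @` [set a | homogeneous_formal n a]).

(* f = \sum_n f_ n, with f_ n of degree n. *)
Definition has_components (f : F) (f_ : nat -> F) : Prop :=
  (forall n, homogeneous n (f_ n)) /\ series f_ @ \oo --> f.

(* r = p ⊗ q, for p of degree k and q of degree l: the continuous extension of
   the product of the tensor algebra. *)
Definition homogeneous_mul (k l : nat) (p q r : F) : Prop :=
  exists a b : nat -> formal_tensor H,
    [/\ forall j, homogeneous_formal k (a j),
        forall j, homogeneous_formal l (b j),
        fock_eval (a j) @[j --> \oo] --> p,
        fock_eval (b j) @[j --> \oo] --> q &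
        fock_eval (formal_mul (a j) (b j)) @[j --> \oo] --> r].

(* h = f ⊗ g. For arbitrary f and g the series of the components of f ⊗ g need
   not converge in F, so the product is a relation. *)
Definition fock_mul (f g h : F) : Prop :=
  exists f_ g_ h_ : nat -> F,
    [/\ has_components f f_, has_components g g_, has_components h h_ &
        forall n, exists r : nat -> F,
          (forall k, (k <= n)%N ->
             homogeneous_mul k (n - k) (f_ k) (g_ (n - k)%N) (r k)) /\
          h_ n = \sum_(0 <= k < n.+1) r k].

End FockProduct.

Definition convolution (R : realType) (u v : nat -> R) (n : nat) : R :=
  \sum_(0 <= a < n.+1) u a * v (n - a)%N.

Definition subconvolutive (R : realType) (u : nat -> R) : Prop :=
  exists C : R, forall n, convolution u u n <= C * u n.

(* Main.v *)
(* Pairing with f ⊠ g forces the value of the coproduct on elementary tensors: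
     Delta (x_1 ⊗ ... ⊗ x_n) = sum_k w(n)^2 / (w(k)^2 w(n-k)^2)
                       (x_1 ⊗ ... ⊗ x_k) ⊠ (x_(k+1) ⊗ ... ⊗ x_n).
   For elementary tensors s, t of degree n this gives
   <Delta s, Delta t> = l_n <s, t> with l_n = w(n)^2 (w^-2 * w^-2)(n), and
   different degrees stay orthogonal. Hence Delta is bounded if and only if l is
   bounded, which is subconvolutivity of w^-2. When Delta is bounded, the product
   is bounded by duality on the span of the s ⊠ t, so it extends to Delta^*. *)
From HB Require Import structures.
From mathcomp Require Import zify.
Require Import Defs.
Import Order.TTheory GRing.Theory Num.Theory.
Import numFieldNormedType.Exports.
Local Open Scope classical_set_scope.
Local Open Scope ring_scope.
Local Open Scope complex_scope.

Set Implicit Arguments.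
Unset Strict Implicit.

(** * Linear maps, closures and density in normed modules *)

Lemma linear_pack (K : nzRingType) (V W : lmodType K) (D : V -> W) :
  linear D -> exists D' : {linear V -> W}, forall x, D x = D' x.
Proof.
move=> Dlin; pose D' : {linear V -> W} := HB.pack_for {linear V -> W} D
  (GRing.isLinear.Build _ _ _ _ D Dlin).
by exists D'.
Qed.

Section NormedModule.
Variable K : numFieldType.

Lemma bounded_linear_continuous (V W : normedModType K) (D : {linear V -> W})
  (M : K) : (forall x, `|D x| <= M * `|x|) -> continuous D.
Proof.
move=> DM x; apply/cvgrPdist_lt => e e0.
have M1 : 0 < `|M| + 1 by rewrite ltr_wpDl.
near=> y; rewrite -linearB.
apply: (le_lt_trans (y := (`|M| + 1) * `|x - y|)).
  have := DM (x - y); have [->|xy] := eqVneq (x - y) 0.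
    by rewrite linear0 !normr0 mulr0.
  move=> DMxy; apply: (le_trans DMxy); rewrite ler_pM2r ?normr_gt0//.
  have M0 : 0 <= M.
    rewrite -(pmulr_lge0 M (x := `|x - y|)) ?normr_gt0//.
    exact: le_trans DMxy.
  by rewrite ger0_norm// lerDl.
rewrite mulrC -ltr_pdivlMr//; near: y.
by apply: cvgr_dist_lt; rewrite ?divr_gt0//; exact: cvg_id.
Unshelve. all: by end_near. Qed.

Lemma closure_normP (V : normedModType K) (A : set V) (x : V) :
  closure A x <-> forall e, 0 < e -> exists2 y, A y & `|x - y| < e.
Proof.
split=> [Ax e e0|Ax B /nbhs_normP[e /= e0 eB]].
  have [y [Ay]] := Ax _ (nbhsx_ballx x e e0).
  by rewrite -ball_normE => xy; exists y.
by have [y Ay xy] := Ax _ e0; exists y; split=> //; exact: eB.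
Qed.

Definition lin_subspace (V : lmodType K) (A : set V) :=
  A 0 /\ forall c x y, A x -> A y -> A (c *: x + y).

Lemma lin_subspace_sum (V : lmodType K) (A : set V) : lin_subspace A ->
  forall I (r : seq I) (P : pred I) (u : I -> V),
  (forall i, P i -> A (u i)) -> A (\sum_(i <- r | P i) u i).
Proof.
move=> [A0 AD] I r P u Au; apply: big_ind => // x y Ax Ay.
by rewrite -[x]scale1r; exact: AD.
Qed.

Lemma lin_subspaceZ (V : lmodType K) (A : set V) : lin_subspace A ->
  forall c x, A x -> A (c *: x).
Proof. by move=> [A0 AD] c x Ax; rewrite -[_ *: _]addr0; exact: AD. Qed.

Lemma closure_subspace (V : normedModType K) (A : set V) :
  lin_subspace A -> lin_subspace (closure A).
Proof.
move=> [A0 AD]; split; first exact: subset_closure.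
move=> c x y /closure_normP Ax /closure_normP Ay; apply/closure_normP => e e0.
have c1 : 0 < `|c| + 1 by rewrite ltr_wpDl.
have [x' Ax' xx'] := Ax (e / 2 / (`|c| + 1)) (divr_gt0 (divr_gt0 e0 (ltr0Sn _ _)) c1).
have [y' Ay' yy'] := Ay (e / 2) (divr_gt0 e0 (ltr0Sn _ _)).
exists (c *: x' + y'); first exact: AD.
rewrite opprD addrACA -scalerBr (le_lt_trans (ler_normD _ _))//.
rewrite [e]splitr ltrD// normrZ (@le_lt_trans _ _ ((`|c| + 1) * `|x - x'|))//.
  by rewrite ler_wpM2r// lerDl.
by rewrite mulrC -ltr_pdivlMr.
Qed.

Lemma dense_normP (V : normedModType K) (A : set V) :
  dense A <-> forall x e, 0 < e -> exists2 y, A y & `|x - y| < e.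
Proof.
split=> [dA x e e0|dA O [x Ox] oO].
  have [||y [xy Ay]] := dA (ball x e).
  - by exists x; exact: ballxx.
  - exact: ball_open.
  by exists y => //; move: xy; rewrite -ball_normE.
have /nbhs_normP[e /= e0 eO] : nbhs x O by exact: open_nbhs_nbhs.
by have [y Ay xy] := dA x _ e0; exists y; split=> //; exact: eO.
Qed.

Lemma closed_eq_fun (T : topologicalType) (W : normedModType K)
  (f g : T -> W) : continuous f -> continuous g -> closed [set x | f x = g x].
Proof.
move=> cf cg; rewrite (_ : [set x | _] = (f \- g) @^-1` [set 0]).
  apply: preimage_closed; last first.
    exact: (@compact_closed W _ (@norm_hausdorff _ W) (@compact_set1 W 0)).
  by move=> x _; apply: cvgB; [exact: cf|exact: cg].
by apply/seteqP; split=> x /=; [move=> ->; rewrite subrr|move/subr0_eq].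
Qed.

End NormedModule.

Lemma closure_seq (R : realType) (V : normedModType R[i]) (A : set V) (x : V) :
  closure A x -> exists2 u : nat -> V, forall n, A (u n) & u @ \oo --> x.
Proof.
move=> /closure_normP Ax.
have /choice[u uP] n : exists y, A y /\ `|x - y| < n.+1%:R^-1.
  by have [|y Ay xy] := Ax n.+1%:R^-1; [rewrite invr_gt0|exists y].
exists u => [n|]; first by case: (uP n).
apply/cvgrPdist_lt => e e0.
(* A positive element of [R[i]] has zero imaginary part, so the choice of [n] reduces to the
   Archimedean property of [R]. *)
have eE : e = (complex.Re e)%:C by case: e e0 => a b; rewrite ltcE => /andP[/eqP/= ->].
have Re0 : 0 < complex.Re e by rewrite -ltcR -eE.
near=> n; have [_ /lt_trans] := uP n; apply.
rewrite eE -[n.+1%:R](rmorph_nat (real_complex R)) -fmorphV ltcR.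
by near: n; exact: near_infty_natSinv_lt (PosNum Re0).
Unshelve. all: by end_near. Qed.

(** * Total families and extension of bounded linear maps *)

Section Total.
Variables (R : realType).
Local Notation K := R[i].
Variables (T : Type) (V : normedModType K) (phi : T -> V).

(** Convertible to [formal_eval] when [T] is [seq H]; the generic index also covers pairs of
    words. *)
Definition lincomb (W : lmodType K) (psi : T -> W) (a : seq (K * T)) : W :=
  \sum_(p <- a) p.1 *: psi p.2.

Lemma lincomb_cat (W : lmodType K) (psi : T -> W) a b :
  lincomb psi (a ++ b) = lincomb psi a + lincomb psi b.
Proof. by rewrite /lincomb big_cat. Qed.

Lemma lincomb_scale (W : lmodType K) (psi : T -> W) c a :
  lincomb psi [seq (c * p.1, p.2) | p <- a] = c *: lincomb psi a.
Proof.
rewrite /lincomb big_map scaler_sumr.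
by apply: eq_bigr => p _; rewrite scalerA.
Qed.

Lemma lincomb1 (W : lmodType K) (psi : T -> W) t :
  lincomb psi [:: (1, t)] = psi t.
Proof. by rewrite /lincomb big_seq1 scale1r. Qed.

Lemma range_lincomb_subspace : lin_subspace (range (lincomb phi)).
Proof.
split; first by exists [::] => //; rewrite /lincomb big_nil.
move=> c _ _ [a _ <-] [b _ <-].
exists ([seq (c * p.1, p.2) | p <- a] ++ b) => //.
by rewrite lincomb_cat lincomb_scale.
Qed.

Definition total := dense (range (lincomb phi)).

Hypothesis phi_total : total.

Lemma total_closure x : closure (range (lincomb phi)) x.
Proof. by apply/closure_normP; have /dense_normP := phi_total; exact. Qed.

Lemma total_approx x e : 0 < e -> exists a, `|x - lincomb phi a| < e.
Proof.
move=> e0; have /dense_normP := phi_total => /(_ x e e0)[_ [a _ <-] xa].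
by exists a.
Qed.

(** Induction principle for density arguments: a closed subspace absorbs the closure of every span
    that it contains. *)
Lemma total_ind (A : set V) : closed A -> lin_subspace A ->
  (forall t, A (phi t)) -> forall x, A x.
Proof.
move=> cA sA Aphi x; apply: cA; apply/closure_normP => e /(total_approx x)[a xa].
exists (lincomb phi a) => //; apply: (lin_subspace_sum sA) => i _.
exact: (lin_subspaceZ sA).
Qed.

Lemma total_eq (W : normedModType K) (D1 D2 : {linear V -> W}) :
  continuous D1 -> continuous D2 -> (forall t, D1 (phi t) = D2 (phi t)) ->
  forall x, D1 x = D2 x.
Proof.
move=> c1 c2 D12; apply: total_ind => //; first exact: closed_eq_fun.
split=> /=; first by rewrite !linear0.
by move=> c x y D12x D12y; rewrite !linearP D12x D12y.
Qed.

(* The closure of the graph {(phi a, psi a)} is the graph of D: it is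
   single-valued by the bound and everywhere defined by completeness of W. *)
Lemma total_extension (W : completeNormedModType K) (psi : T -> W) (M : K) :
  0 <= M -> (forall a, `|lincomb psi a| <= M * `|lincomb phi a|) ->
  exists D : {linear V -> W},
    (forall t, D (phi t) = psi t) /\ forall x, `|D x| <= M * `|x|.
Proof.
move=> M0 psiM.
have M1 : 0 < M + 1 by rewrite ltr_wpDl.
(* The tolerance that, multiplied by [M + 1], gives [e / 2]; [M] itself may be zero. *)
have half e : 0 < e -> 0 < e / 2 / (M + 1) by move=> e0; rewrite !divr_gt0.
pose G : set (V * W) := closure (range (fun a => (lincomb phi a, lincomb psi a))).
have [G0 GD] : lin_subspace G.
  apply: closure_subspace; split; first by exists [::]; rewrite // /lincomb !big_nil.
  move=> c _ _ [a _ <-] [b _ <-].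
  exists ([seq (c * p.1, p.2) | p <- a] ++ b) => //.
  by rewrite !lincomb_cat !lincomb_scale.
have GM x y : G (x, y) -> `|y| <= M * `|x|.
  move=> /closure_normP Gxy; apply/ler_addgt0Pr => e e0.
  have [_ [a _ <-]] := Gxy _ (half e e0).
  rewrite prod_normE/= comparable_gt_max ?real_comparable//.
  move=> /andP[xa ya].
  apply: (le_trans (y := `|y - lincomb psi a| + M * `|lincomb phi a|)).
    rewrite (le_trans _ (lerD (lexx _) (psiM a)))//.
    by rewrite -{1}[y](subrK (lincomb psi a)) ler_normD.
  apply: (le_trans (y := e / 2 / (M + 1) + M * (`|x| + e / 2 / (M + 1)))).
    rewrite lerD ?(ltW ya)// ler_wpM2l//.
    rewrite -{1}[lincomb phi a](subKr x) (le_trans (ler_normB _ _))//.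
    by rewrite lerD2l ltW.
  rewrite mulrDr addrCA lerD2l -{1}[e / 2 / _]mul1r -mulrDl addrC.
  by rewrite mulrC divfK ?gt_eqF// ler_pdivrMr// ler_peMr ?ltW// ltr1n.
have G_ex x : exists y, G (x, y).
  have [u a_ ax] := closure_seq (@total_closure x).
  have /choice[a aP] n : exists a, lincomb phi a = u n.
    by have [a _ <-] := a_ n; exists a.
  have {}ax : lincomb phi (a n) @[n --> \oo] --> x.
    by rewrite (_ : (fun n => _) = u)//; apply/funext.
  have xaN e : 0 < e -> \forall n \near \oo, `|x - lincomb phi (a n)| < e.
    by move: ax => /cvgrPdist_lt; exact.
  have /cauchy_cvgP ay : cauchy (lincomb psi (a n) @[n --> \oo]).
    apply: cauchy_exP => e e0.
    have [N _ aN] := xaN _ (half e e0).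
    exists (lincomb psi (a N)); exists N => // n /= Nn.
    rewrite -ball_normE /=.
    (* The bound for the formal difference of [a N] and [a n] transfers the Cauchy property from
       [phi] to [psi]. *)
    have := psiM (a N ++ [seq (-1 * p.1, p.2) | p <- a n]).
    rewrite !lincomb_cat !lincomb_scale !scaleN1r => /le_lt_trans; apply.
    apply: (@le_lt_trans _ _ ((M + 1) * `|lincomb phi (a N) - lincomb phi (a n)|)).
      by rewrite ler_wpM2r// lerDl.
    rewrite mulrC -ltr_pdivlMr// [e]splitr mulrDl.
    apply: (le_lt_trans (ler_distD x _ _)); rewrite distrC.
    by apply: ltrD; apply: aN => /=.
  exists (lim (lincomb psi (a n) @[n --> \oo])).
  apply: (closed_cvg (u_ := fun n => (lincomb phi (a n), lincomb psi (a n))) (F := \oo) G).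
  - exact: closed_closure.
  - by apply: nearW => n; apply: subset_closure; exists (a n).
  - by apply: cvg_pair.
have G_uniq x y y' : G (x, y) -> G (x, y') -> y = y'.
  (* The difference of the two pairs lies in [G] over the zero vector, where [GM] kills the second
     entry. *)
  move=> Gy Gy'; have := GM (-1 *: x + x) (-1 *: y + y') (GD _ _ _ Gy Gy').
  rewrite !scaleN1r addNr normr0 mulr0 normr_le0 addrC subr_eq0.
  by move=> /eqP.
have [D DP] := choice G_ex.
have Dlin : linear D.
  by move=> c x x'; apply: (G_uniq (c *: x + x')) => //; exact: (GD c _ _ (DP x) (DP x')).
have [D' DD'] := linear_pack Dlin.
exists D'; split=> [t|x]; last by rewrite -DD'; exact: GM.
rewrite -DD'; apply: (G_uniq (phi t)) => //; apply: subset_closure.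
by exists [:: (1, t)]; rewrite // !lincomb1.
Qed.
End Total.

(** * Inner products: Cauchy-Schwarz, continuity, separation of points *)

Section Inner.
Variables (R : realType) (H : hilbertType R).
Implicit Types (x y z : H) (c : R[i]).

Lemma inner_linear x : linear_for *%R (inner x).
Proof. by move=> c y z; rewrite /inner linearPl. Qed.

HB.instance Definition _ x :=
  GRing.isLinear.Build R[i] H R[i] *%R (inner x) (inner_linear x).

Lemma innerC x y : inner y x = Num.conj (inner x y).
Proof. by rewrite /inner [LHS]hermC /= expr0 mul1r. Qed.

Lemma innerDl x y z : inner (x + y) z = inner x z + inner y z.
Proof. by rewrite !(innerC z) linearD rmorphD. Qed.

Lemma innerZl c x y : inner (c *: x) y = Num.conj c * inner x y.
Proof. by rewrite !(innerC y) linearZ rmorphM. Qed.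

Lemma inner0l x : inner 0 x = 0.
Proof. by rewrite innerC linear0 rmorph0. Qed.

Lemma inner_suml I (r : seq I) (P : pred I) (u : I -> H) x :
  inner (\sum_(i <- r | P i) u i) x = \sum_(i <- r | P i) inner (u i) x.
Proof.
by rewrite innerC linear_sum rmorph_sum; apply: eq_bigr => i _; rewrite [RHS]innerC.
Qed.

Lemma inner_norm x : inner x x = `|x| ^+ 2.
Proof. by rewrite sqr_norm_hdot. Qed.

(** Write [y = z + c *: x] with [z] orthogonal to [x]; by Pythagoras [c *: x] is no longer than [y],
    which is the claim divided by the norm of [x]. *)
Lemma CauchySchwarz_inner x y : `|inner x y| <= `|x| * `|y|.
Proof.
have [->|x0] := eqVneq x 0; first by rewrite inner0l !normr0 mul0r.
have nx : 0 < `|x| by rewrite normr_gt0.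
pose c := inner x y / inner x x; pose z := y - c *: x.
have zx : inner x z = 0.
  by rewrite linearB linearZ /= divfK ?subrr// inner_norm expf_neq0// gt_eqF.
have -> : inner x y = c * `|x| ^+ 2.
  by rewrite -inner_norm divfK// inner_norm expf_neq0// gt_eqF.
rewrite normrM normrX normr_id mulrC -mulrA ler_pM2l// mulrC.
have -> : `|c| * `|x| = `|c *: x| by rewrite normrZ.
rewrite -ler_sqr ?nnegrE// -!inner_norm.
have -> : y = z + c *: x by rewrite subrK.
clearbody z; rewrite [leRHS]innerDl !linearD /=.
rewrite (innerC (c *: x) z) !(innerZl _ _ z) zx mulr0 rmorph0 addr0 add0r.
by rewrite lerDr inner_norm exprn_ge0.
Qed.

Lemma inner_continuous x : continuous (inner x : H -> R[i]^o).
Proof.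
have [f fE] := @linear_pack R[i] H R[i]^o (inner x) (inner_linear x).
rewrite (_ : inner x = f); last exact/funext.
by apply: (@bounded_linear_continuous _ _ _ f `|x|) => y; rewrite -fE CauchySchwarz_inner.
Qed.

(** The vector [x - y] is orthogonal to the family, hence by density and continuity to itself. *)
Lemma inner_total_eq T (phi : T -> H) x y : total phi ->
  (forall t, inner (phi t) x = inner (phi t) y) -> x = y.
Proof.
move=> tphi xy; apply/subr0_eq.
have [f fE] := @linear_pack R[i] H R[i]^o _ (inner_linear (x - y)).
have f0 : forall z, f z = (\0 : {linear H -> R[i]^o}) z.
  apply: (total_eq tphi).
  - by rewrite -(_ : inner (x - y) = f); [exact: inner_continuous|exact/funext].
  - exact: cst_continuous.
  - by move=> t; rewrite -fE /= innerC linearB /= xy subrr rmorph0.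
apply/eqP; rewrite -normr_eq0 -sqrf_eq0 -inner_norm.
by apply/eqP; rewrite fE f0.
Qed.
End Inner.

(** * Hilbert tensor products: joint continuity and totality *)

Section Tensor.
Variables (R : realType) (H K : hilbertType R) (HK : hilbertTensor H K).
Implicit Types (x : H) (y : K).

HB.instance Definition _ x :=
  GRing.isLinear.Build R[i] K HK *:%R (boxt HK x) (boxt_linearr HK x).

(** With the left factor as last argument, linearity in it can be declared as an instance. *)
Definition boxtr y x : HK := x ⊠ y.

HB.instance Definition _ y :=
  GRing.isLinear.Build R[i] H HK *:%R (boxtr y) (boxt_linearl HK y).

Lemma boxtZl (c : R[i]) x y : (c *: x) ⊠ y = c *: (x ⊠ y : HK).
Proof. by rewrite -[LHS]/(boxtr y (c *: x)) linearZ. Qed.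

Lemma boxt_suml I (r : seq I) (P : pred I) (u : I -> H) y :
  (\sum_(i <- r | P i) u i) ⊠ y = \sum_(i <- r | P i) (u i ⊠ y : HK).
Proof. exact: (linear_sum (boxtr y)). Qed.

Lemma norm_boxt x y : `|(x ⊠ y : HK)| = `|x| * `|y|.
Proof.
apply/eqP; rewrite -(@eqrXn2 _ 2) ?mulr_ge0//; apply/eqP.
by rewrite exprMn -!inner_norm inner_boxt.
Qed.

Lemma boxt_continuous x : continuous (boxt HK x).
Proof.
apply: (@bounded_linear_continuous _ _ _ (boxt HK x) `|x|) => y.
by rewrite norm_boxt.
Qed.

Lemma boxtr_continuous y : continuous (boxtr y).
Proof.
apply: (@bounded_linear_continuous _ _ _ (boxtr y) `|y|) => x.
by rewrite norm_boxt mulrC.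
Qed.

Lemma cvg_boxt (F : set_system nat) (FF : Filter F) (u : nat -> H) (v : nat -> K) x y :
  u @ F --> x -> v @ F --> y -> ((u n ⊠ v n : HK) @[n --> F]) --> (x ⊠ y : HK).
Proof.
move=> ux vy.
have uxy : (boxtr y (u n) @[n --> F]) --> (boxtr y x).
  by apply: continuous_cvg => //; exact: boxtr_continuous.
(* Splits [u n ⊠ v n] as [u n ⊠ y] plus [u n ⊠ (v n - y)]; the norm of the latter is a convergent
   factor times one tending to zero. *)
suff : ((u n ⊠ (v n - y) : HK) @[n --> F]) --> (0 : HK).
  move=> /(cvgD uxy); rewrite addr0; apply: cvg_trans.
  apply: near_eq_cvg; apply: nearW => n /=.
  by rewrite fctE linearB addrC subrK.
apply/norm_cvg0P.
rewrite (_ : (fun n => _) = (fun n => `|u n| * `|v n - y|)).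
  have -> : (0 : R[i]^o) = `|x| * 0 by rewrite mulr0.
  apply: cvgM; first exact: cvg_norm.
  by apply/norm_cvg0P; rewrite -(subrr y); apply: cvgB => //; exact: cvg_cst.
by apply/funext => n; rewrite norm_boxt.
Qed.

Lemma total_pure_boxt : total (fun p : H * K => (p.1 ⊠ p.2 : HK)).
Proof.
apply/dense_normP => z e e0.
have /dense_normP/(_ z e e0)[_ [a _ <-] za] := @boxt_total _ _ _ HK.
exists (\sum_(p <- a) p.1 ⊠ p.2) => //.
exists [seq (1, p) | p <- a] => //.
by rewrite /lincomb big_map; apply: eq_bigr => p _; rewrite scale1r.
Qed.

(** Density induction over pure tensors, then over the left factor, then over the right one. *)
Lemma total_boxt S T (phi : S -> H) (psi : T -> K) : total phi -> total psi ->
  total (fun p : S * T => (phi p.1 ⊠ psi p.2 : HK)).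
Proof.
move=> tphi tpsi; set chi := fun p => _.
have sC := closure_subspace (range_lincomb_subspace chi).
apply/dense_normP => z e; move: e; apply/closure_normP.
move: z; apply: (total_ind total_pure_boxt) => //; first exact: closed_closure.
case=> x y /=; move: x.
apply: (total_ind tphi (A := boxtr y @^-1` closure _)).
- by apply: preimage_closed; [move=> x _; exact: boxtr_continuous|exact: closed_closure].
- split=> /=; first by rewrite linear0; case: sC.
  by move=> c x x' ? ?; rewrite linearP; case: sC => _; exact.
move=> s /=; rewrite /boxtr; move: y.
apply: (total_ind tpsi (A := boxt HK (phi s) @^-1` closure _)).
- by apply: preimage_closed; [move=> x _; exact: boxt_continuous|exact: closed_closure].
- split=> /=; first by rewrite linear0; case: sC.
  by move=> c x x' ? ?; rewrite linearP; case: sC => _; exact.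
move=> t /=; apply: subset_closure; exists [:: (1, (s, t))] => //.
by rewrite lincomb1.
Qed.
End Tensor.

(** * Real scalars; extension of inner product identities by continuity *)

Lemma complex_real (R : realType) (x : R) : x%:C \is Num.real.
Proof. by rewrite realE !lecR -realE num_real. Qed.

Lemma closed_inner_eq (R : realType) (V V1 V2 : hilbertType R)
  (D1 : V -> V1) (D2 : V -> V2) y z : continuous D1 -> continuous D2 ->
  closed [set x | inner y (D1 x) = inner z (D2 x)].
Proof.
move=> c1 c2; apply: (@closed_eq_fun R[i] V R[i]^o) => x.
  exact: (continuous_comp (c1 x) (@inner_continuous R V1 y (D1 x))).
exact: (continuous_comp (c2 x) (@inner_continuous R V2 z (D2 x))).
Qed.

(** Since [y] and [z] may lie in different spaces, an adjointness relation can be checked on a total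
    family by taking [D1] or [D2] to be the identity. *)
Lemma inner_total_ext (R : realType) (V V1 V2 : hilbertType R) T (phi : T -> V)
  (D1 : {linear V -> V1}) (D2 : {linear V -> V2}) y z :
  total phi -> continuous D1 -> continuous D2 ->
  (forall t, inner y (D1 (phi t)) = inner z (D2 (phi t))) ->
  forall x, inner y (D1 x) = inner z (D2 x).
Proof.
move=> tphi c1 c2 yz; apply: (total_ind tphi) => //; first exact: closed_inner_eq.
split=> /=; first by rewrite !linear0.
by move=> c x x'; rewrite !linearP /= => -> ->.
Qed.

Lemma cvg_inner (R : realType) (V : hilbertType R) (x y : V) (u : nat -> V) :
  u @ \oo --> y -> (inner x (u n) : R[i]^o) @[n --> \oo] --> (inner x y : R[i]^o).
Proof. by move=> uy; apply: (continuous_cvg _ _ uy); exact: inner_continuous. Qed.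

Lemma bounded_operator_linear (R : realType) (V W : hilbertType R) (D : V -> W) :
  bounded_operator D ->
  exists2 D' : {linear V -> W}, D = D' :> (V -> W) & continuous D'.
Proof.
move=> [Dlin [M DM]]; have [D' DD'] := linear_pack Dlin.
exists D'; first exact/funext.
by apply: (@bounded_linear_continuous _ _ _ D' M%:C) => x; rewrite -DD'.
Qed.

(** * Grading of the Fock space: degree-diagonal operators and components *)

Section Fock.
Variables (R : realType) (H : hilbertType R) (w : nat -> R).
Hypothesis w_gt0 : forall n, 0 < w n.
Variable F : fullFock H w.
Implicit Types s t v : seq H.
Local Notation elem := (@elem R H w F).

Lemma total_elem : total elem.
Proof. exact: elem_total. Qed.

Lemma inner_elem_neq s t : size s != size t -> inner (elem s) (elem t) = 0.
Proof. by move=> st; rewrite inner_elem (negPf st). Qed.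

Definition part n (a : formal_tensor H) : formal_tensor H :=
  [seq p <- a | size p.2 == n].

(* Distinct degrees are orthogonal, so a Gram matrix that is a multiple of that
   of elem in each degree only rescales the graded pieces of the norm. *)
Lemma gram_lincomb (K : hilbertType R) (psi : seq H -> K) (c : nat -> R) N a :
  (forall s t, inner (psi s) (psi t) = (c (size s))%:C * inner (elem s) (elem t)) ->
  all (fun p => size p.2 < N)%N a ->
  `|lincomb psi a| ^+ 2 =
    \sum_(n < N) (c n)%:C * `|lincomb elem (part n a)| ^+ 2.
Proof.
move=> psic aN.
(* By orthogonality of degrees one argument may be the full [a], which makes the sum over [n]
   collapse below. *)
have partE n : inner (lincomb elem (part n a)) (lincomb elem (part n a)) =
    inner (lincomb elem (part n a)) (lincomb elem a).
  rewrite /lincomb !big_filter !inner_suml; apply: eq_bigr => p /eqP pn.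
  rewrite !linear_sum /= [RHS](bigID (fun q => size q.2 == n)) /=.
  rewrite [X in _ = _ + X]big1 ?addr0// => q qn.
  by rewrite innerZl linearZ /= inner_elem_neq ?mulr0// pn eq_sym.
rewrite -inner_norm.
under [RHS]eq_bigr do rewrite -inner_norm partE /lincomb big_filter inner_suml.
under [RHS]eq_bigr do rewrite big_distrr big_mkcond /=.
rewrite exchange_big /= inner_suml big_seq [RHS]big_seq; apply: eq_bigr => p pa.
have pN : (size p.2 < N)%N by have /allP/(_ _ pa) := aN.
rewrite (bigD1 (Ordinal pN)) //= eqxx [X in _ + X]big1 ?addr0; last first.
  by move=> i; case: ifP => // /eqP pi /eqP[]; apply: val_inj => /=.
rewrite !innerZl mulrCA !linear_sum; congr (_ * _); rewrite big_distrr.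
by apply: eq_bigr => q _; rewrite !linearZ /= psic mulrCA.
Qed.

(** By [gram_lincomb] both norms split over the same degrees, so [c n <= C ^+ 2] compares them term
    by term. *)
Lemma diagonal_extension (K : hilbertType R) (psi : seq H -> K) (c : nat -> R) C :
  0 <= C -> (forall n, c n <= C ^+ 2) ->
  (forall s t, inner (psi s) (psi t) = (c (size s))%:C * inner (elem s) (elem t)) ->
  exists D : {linear F -> K},
    (forall s, D (elem s) = psi s) /\ forall x, `|D x| <= C%:C * `|x|.
Proof.
move=> C0 cC psic; apply: (total_extension total_elem); first by rewrite lecR.
move=> a; have [N aN] : exists N, all (fun p : R[i] * seq H => size p.2 < N)%N a.
  exists (\max_(p <- a) size p.2).+1; apply/allP => p pa.
  by rewrite ltnS; exact: (@leq_bigmax_seq _ _ xpredT (fun p : R[i] * seq H => size p.2)).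
rewrite -ler_sqr ?nnegrE ?mulr_ge0 ?lecR// exprMn.
rewrite (gram_lincomb psic aN) (@gram_lincomb _ elem (fun=> 1) N)//; last first.
  by move=> s t; rewrite mul1r.
rewrite mulr_sumr ler_sum// => n _.
by rewrite mul1r ler_wpM2r ?exprn_ge0// -rmorphXn lecR.
Qed.

Lemma degree_projection (P : pred nat) : exists D : {linear F -> F},
  (forall s, D (elem s) = if P (size s) then elem s else 0) /\
  forall x, `|D x| <= `|x|.
Proof.
have [||s t|D [De D1]] := @diagonal_extension _
  (fun s => if P (size s) then elem s else 0) (fun n => (P n)%:R) 1.
- exact: ler01.
- by move=> n; rewrite expr1n; case: (P n).
- case: ifPn => Ps; last by rewrite inner0l mul0r.
  rewrite mul1r; case: ifPn => Pt//.
  rewrite linear0 inner_elem_neq//; apply: contraNneq Pt => <- //.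
by exists D; split=> // x; have := D1 x; rewrite mul1r.
Qed.

Lemma homogeneous_subspace n : lin_subspace (@homogeneous R H w F n).
Proof.
apply: closure_subspace; split.
  by exists [::]; rewrite // /fock_eval /formal_eval big_nil.
move=> c _ _ [a an <-] [b bn <-].
exists ([seq (c * p.1, p.2) | p <- a] ++ b).
  by rewrite /= /homogeneous_formal all_cat all_map; apply/andP; split.
by rewrite /fock_eval /formal_eval; have := lincomb_cat elem; rewrite /lincomb => ->;
  have := lincomb_scale elem; rewrite /lincomb => ->.
Qed.

Lemma homogeneous_elem s : homogeneous (size s) (elem s).
Proof.
apply: subset_closure; exists [:: (1, s)]; last exact: (lincomb1 elem).
by rewrite /= /homogeneous_formal /= eqxx.
Qed.

(** Orthogonality holds for formal tensors of degree [n] and is a closed condition. *)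
Lemma homogeneous_inner n (x : F) v :
  homogeneous n x -> size v != n -> inner (elem v) x = 0.
Proof.
move=> xn vn; suff /(_ x xn) : homogeneous n `<=` [set x | inner (elem v) x = 0] by [].
rewrite -(@linear0 _ _ _ _ (inner (elem v))).
have /closure_id -> : closed [set x | inner (elem v) x = inner (elem v) 0].
  by apply: closed_inner_eq => y; [exact: cvg_id|exact: cst_continuous].
apply: closure_subset => _ [a /allP an <-] /=.
rewrite linear0 linear_sum /= big_seq big1// => p /an /eqP pn.
by rewrite linearZ /= inner_elem_neq ?mulr0// pn.
Qed.

Lemma has_components_inner (f : F) f_ v : has_components f f_ ->
  inner (elem v) f = inner (elem v) (f_ (size v)).
Proof.
move=> [fn ff].
apply: (closed_cvg (fun x => inner (elem v) x = inner (elem v) (f_ (size v)))) ff.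
  by apply: closed_inner_eq => y; [exact: cvg_id|exact: cst_continuous].
(* [series] at [N] sums the degrees below [N], so degree [size v] is included from this index on. *)
exists (size v).+1 => // N /= vN.
rewrite /series /= linear_sum big_mkord (bigD1 (Ordinal vN))//= big1 ?addr0// => i.
by move=> iv; apply: (homogeneous_inner (fn i)); rewrite eq_sym.
Qed.

(** Components are differences of successive truncations [S N] to degrees below [N]. These
    contractions eventually fix each finite combination of words, hence converge pointwise to the
    identity. *)
Lemma degree_components : exists P : nat -> {linear F -> F},
  forall f, has_components f (P^~ f).
Proof.
have /choice[S SP] N := @degree_projection (fun m => (m < N)%N).
have SE N : forall s, S N (elem s) = if (size s < N)%N then elem s else 0.
  by case: (SP N).
have S1 N : forall x, `|S N x| <= `|x| by case: (SP N).
have Sc N : continuous (S N).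
  by apply: (@bounded_linear_continuous _ _ _ (S N) 1) => x; rewrite mul1r.
have S0 x : S 0%N x = 0.
  apply: (total_eq total_elem (D1 := S 0%N) (D2 := \0)) => [||s].
  - exact: Sc.
  - exact: cst_continuous.
  - by rewrite SE.
exists (fun n => S n.+1 \- S n) => f; split=> [n|].
  move: f; apply: (total_ind total_elem (A := (S n.+1 \- S n) @^-1` homogeneous n)).
  - apply: preimage_closed; last exact: closed_closure.
    by move=> x _; apply: cvgB; exact: Sc.
  - have [h0 hD] := homogeneous_subspace n.
    split; first by rewrite /preimage /mkset linear0.
    by move=> c x y Dx Dy; rewrite /preimage /mkset linearP; exact: hD.
  move=> s /=; rewrite !SE; case: (ltngtP (size s) n) => [sn|sn|<-].
  - by rewrite ltnW// subrr; case: (homogeneous_subspace n).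
  - by rewrite ltnNge sn subrr; case: (homogeneous_subspace n).
  - by rewrite ltnSn subr0; exact: homogeneous_elem.
have -> : series (fun n => (S n.+1 \- S n) f) = fun N => S N f.
  by apply/funext => N; rewrite /series /= telescope_sumr// S0 subr0.
apply/cvgrPdist_lt => e e0.
have [a fa] := total_approx total_elem f (divr_gt0 e0 (ltr0Sn _ 1)).
exists (\max_(p <- a) size p.2).+1 => // N /= aN.
have Sa : S N (lincomb elem a) = lincomb elem a.
  rewrite /lincomb linear_sum big_seq [RHS]big_seq; apply: eq_bigr => p pa.
  rewrite linearZ SE ifT//; apply: leq_ltn_trans aN.
  exact: (@leq_bigmax_seq _ _ xpredT (fun p : R[i] * seq H => size p.2)).
rewrite [e]splitr; apply: (le_lt_trans (ler_distD (lincomb elem a) _ _)).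
apply: ltrD => //; rewrite -{1}Sa -linearB.
by apply: (le_lt_trans (S1 _ _)); rewrite distrC.
Qed.

(** * Comultiplication on elementary tensors and its Gram matrix *)

Definition comul_coef n k : R := w n ^+ 2 / (w k ^+ 2 * w (n - k)%N ^+ 2).

Definition comul_norm n : R := \sum_(0 <= k < n.+1) comul_coef n k.

Lemma comul_normE n : comul_norm n = w n ^+ 2 *
  convolution (fun n => (w n ^+ 2)^-1) (fun n => (w n ^+ 2)^-1) n.
Proof.
by rewrite mulr_sumr; apply: eq_bigr => k _; rewrite /comul_coef invfM.
Qed.

Variable FF : hilbertTensor F F.

Definition comul s : FF := \sum_(0 <= k < (size s).+1)
  (comul_coef (size s) k)%:C *: (elem (take k s) ⊠ elem (drop k s)).

Lemma inner_boxt_comul (f g : F) v : inner (comul v) (f ⊠ g) =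
  \sum_(0 <= k < (size v).+1) (comul_coef (size v) k)%:C *
     (inner (elem (take k v)) f * inner (elem (drop k v)) g).
Proof.
rewrite inner_suml; apply: eq_bigr => k _.
by rewrite innerZl (conj_Creal (complex_real _)) inner_boxt.
Qed.

(** [comul] is adjoint to concatenation: its coefficient replaces the weights w(k)^2 w(l)^2 of the
    two factors by w(k+l)^2. *)
Lemma inner_elem_cat s t v : inner (comul v) (elem s ⊠ elem t) =
  inner (elem v) (elem (s ++ t)).
Proof.
rewrite inner_boxt_comul big_mkord.
have [vst|vst] := eqVneq (size v) (size (s ++ t)); last first.
  rewrite inner_elem_neq// big1// => k _.
  have [sk|sk] := eqVneq (size (take k v)) (size s); last first.
    by rewrite (inner_elem_neq sk) mul0r mulr0.
  rewrite (@inner_elem_neq (drop k v)) ?mulr0//; apply: contraNneq vst => dt.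
  by rewrite size_cat -sk -dt -size_cat cat_take_drop.
have sv : (size s < (size v).+1)%N by rewrite vst size_cat ltnS leq_addr.
(* Only the cut of v at position [size s] matches the degrees of s and t. *)
rewrite (bigD1 (Ordinal sv))//= big1 ?addr0; last first.
  move=> k ks; rewrite inner_elem_neq ?mul0r ?mulr0//.
  by rewrite size_takel//; have := ltn_ord k; rewrite ltnS.
have sz1 : size (take (size s) v) = size s by rewrite size_takel// vst size_cat leq_addr.
have sz2 : size (drop (size s) v) = size t by rewrite size_drop vst size_cat addKn.
rewrite !inner_elem sz1 sz2 vst !eqxx.
rewrite -{3}[v](cat_take_drop (size s)) zip_cat ?sz1// big_cat /=.
rewrite /comul_coef size_cat addKn.
rewrite [X in _ * X = _]mulrACA [LHS]mulrA -!rmorphM /= divfK//.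
by rewrite mulf_neq0// expf_neq0// gt_eqF.
Qed.

Lemma inner_comul s t : inner (comul s) (comul t) =
  (comul_norm (size s))%:C * inner (elem s) (elem t).
Proof.
(* Only [comul t] is expanded: each cut of [t] reassembles to [t], leaving the sum of the
   coefficients for [size t]. For unequal lengths both sides vanish. *)
rewrite {2}/comul linear_sum /=.
under eq_bigr do rewrite linearZ /= inner_elem_cat cat_take_drop.
rewrite -mulr_suml -rmorph_sum /=.
have [->|st] := eqVneq (size s) (size t); first by [].
by rewrite inner_elem_neq// !mulr0.
Qed.

Lemma comul_norm_ge0 n : 0 <= comul_norm n.
Proof. by apply: sumr_ge0 => k _; rewrite divr_ge0 ?mulr_ge0 ?exprn_ge0// ltW. Qed.

(** * The Fock space product tested against words *)

Lemma inner_formal_mul a b v : inner (elem v) (fock_eval F (formal_mul a b)) =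
  inner (comul v) (fock_eval F a ⊠ fock_eval F b).
Proof.
rewrite /fock_eval /formal_eval big_flatten big_map linear_sum.
rewrite boxt_suml linear_sum; apply: eq_bigr => p _.
rewrite big_map !linear_sum; apply: eq_bigr => q _.
by rewrite linearZ /= -inner_elem_cat boxtZl !linearZ /= mulrA.
Qed.

(** The identity for formal tensors passes to the limit, whichever approximating sequences are
    chosen. *)
Lemma homogeneous_mul_inner k l (p q r : F) v : homogeneous_mul k l p q r ->
  inner (elem v) r = inner (comul v) (p ⊠ q).
Proof.
move=> [a [b [_ _ ap bq abr]]].
have h1 := @cvg_inner _ _ (elem v) _ _ abr.
have h2 := @cvg_inner _ _ (comul v) _ _ (@cvg_boxt _ _ _ FF _ _ _ _ _ _ ap bq).
apply: (cvg_unique (@norm_hausdorff _ R[i]^o) h1).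
have E : (fun j => inner (elem v) (fock_eval F (formal_mul (a j) (b j)))) =
   (fun j => inner (comul v) (fock_eval F (a j) ⊠ fock_eval F (b j))).
  by apply/funext => j; exact: inner_formal_mul.
by rewrite E; exact: h2.
Qed.

(** The two pieces of a cut of [v] have degrees adding up to [size v], so only [n = size v]
    contributes; then the cut at [k] meets exactly the components of degrees [k] and [n - k]. *)
Lemma comul_components n (f g : F) f_ g_ v :
  has_components f f_ -> has_components g g_ ->
  \sum_(0 <= k < n.+1) inner (comul v) (f_ k ⊠ g_ (n - k)%N) =
  if size v == n then inner (comul v) (f ⊠ g) else 0.
Proof.
move=> ff gg; have [fn gn] := (ff.1, gg.1).
case: eqP => [<-|vn]; last first.
  rewrite big_nat big1// => k /andP[_ kn].
  rewrite inner_boxt_comul big_nat big1// => j /andP[_ jv].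
  have [jk|jk] := eqVneq j k; last first.
    by rewrite (homogeneous_inner (fn k)) ?mul0r ?mulr0// size_takel.
  rewrite (homogeneous_inner (gn _)) ?mulr0// size_drop jk.
  by apply/eqP; lia.
rewrite inner_boxt_comul big_nat [RHS]big_nat; apply: eq_bigr => k /andP[_ kv].
rewrite inner_boxt_comul big_mkord (bigD1 (Ordinal kv))//= big1 ?addr0; last first.
  move=> j jk; rewrite (homogeneous_inner (fn k)) ?mul0r ?mulr0//.
  by rewrite size_takel//; have := ltn_ord j; rewrite ltnS.
rewrite (has_components_inner _ ff) (has_components_inner _ gg).
by rewrite size_takel// size_drop.
Qed.

(* The relation fock_mul is thus functional: the right-hand side does not
   mention h, and the elementary tensors are total. *)
Lemma fock_mul_inner (f g h : F) v : fock_mul f g h ->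
  inner (elem v) h = inner (comul v) (f ⊠ g).
Proof.
move=> [f_ [g_ [h_ [ff gg hh fgh]]]].
rewrite (has_components_inner _ hh).
have [r [rP ->]] := fgh (size v).
have := comul_components (size v) v ff gg; rewrite eqxx => <-.
rewrite linear_sum big_nat [RHS]big_nat; apply: eq_bigr => k /andP[_ kv].
exact: homogeneous_mul_inner (rP k kv).
Qed.

(** * Uniqueness, necessity of subconvolutivity, and construction of the coproduct *)

Lemma coproduct_elem (D : F -> FF) Dstar s : is_adjoint D Dstar ->
  (forall f g : F, fock_mul f g (Dstar (f ⊠ g))) -> D (elem s) = comul s.
Proof.
move=> adj mulP; apply: (inner_total_eq (@total_pure_boxt _ _ _ FF)) => -[f g] /=.
(* Adjointness turns the pairing with [f ⊠ g] into that of the word with the product, which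
   [fock_mul_inner] evaluates. *)
by rewrite -adj innerC [RHS]innerC (fock_mul_inner _ (mulP f g)).
Qed.

Lemma coproduct_unique (D1 D2 : F -> FF) :
  bounded_operator D1 -> bounded_operator D2 ->
  (forall s, D1 (elem s) = D2 (elem s)) -> D1 = D2.
Proof.
move=> /bounded_operator_linear[D1' -> c1] /bounded_operator_linear[D2' -> c2] D12.
by apply/funext; exact: (total_eq total_elem).
Qed.

(** Tensor powers of [x] are nonzero in every degree; on them the squared norm ratio is
    [comul_norm n], whence the constant [M ^+ 2]. *)
Lemma comul_bounded_subconvolutive (x : H) (M : R) : x != 0 ->
  (forall s, `|comul s| <= M%:C * `|elem s|) ->
  subconvolutive (fun n => (w n ^+ 2)^-1).
Proof.
move=> x0 comulM; exists (M ^+ 2) => n.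
rewrite -ler_pdivrMr ?invr_gt0 ?exprn_gt0// invrK mulrC -comul_normE.
pose s := nseq n x.
have es : 0 < `|elem s| ^+ 2.
  rewrite -inner_norm inner_elem eqxx mulr_gt0 ?ltcR ?exprn_gt0//.
  rewrite /s; elim: (n) => [|m IH] /=; first by rewrite big_nil.
  by rewrite big_cons mulr_gt0// inner_norm exprn_gt0// normr_gt0.
have : `|comul s| ^+ 2 <= (M%:C * `|elem s|) ^+ 2.
  by rewrite ler_sqr ?nnegrE//; exact: le_trans (comulM s).
rewrite -inner_norm inner_comul exprMn inner_norm ler_pM2r//.
by rewrite size_nseq -rmorphXn lecR.
Qed.

Lemma coproduct_exists : subconvolutive (fun n => (w n ^+ 2)^-1) ->
  exists (D : {linear F -> FF}) (Dstar : {linear FF -> F}),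
  [/\ bounded_operator D, is_adjoint D Dstar, continuous Dstar &
     forall s t, Dstar (elem s ⊠ elem t) = elem (s ++ t)].
Proof.
move=> [C subC].
have normC n : comul_norm n <= C.
  by rewrite comul_normE mulrC -ler_pdivlMr ?exprn_gt0.
have C0 : 0 <= C by exact: le_trans (comul_norm_ge0 0) (normC 0%N).
(* [diagonal_extension] compares the Gram factor with the square of the operator bound. *)
pose B := Num.sqrt C; have B0 : 0 <= B by exact: sqrtr_ge0.
have [|D [De DB]] := diagonal_extension B0 _ inner_comul.
  by move=> n; rewrite sqr_sqrtr.
have Dc : continuous D by exact: bounded_linear_continuous DB.
have idc : continuous (idfun : F -> F) by move=> x; exact: cvg_id.
have tphi := total_boxt (HK := FF) total_elem total_elem.
(* The adjunction is extended from words to all [x] before [Dstar] exists; it is what bounds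
   concatenation below. *)
have mul_adj s t x : inner (elem (s ++ t)) x = inner (elem s ⊠ elem t) (D x).
  apply: (@inner_total_ext _ _ _ _ _ _ idfun D _ _ total_elem) => // v /=.
  by rewrite De innerC -inner_elem_cat -innerC.
pose phi p : FF := elem p.1 ⊠ elem p.2.
pose psi (p : seq H * seq H) : F := elem (p.1 ++ p.2).
have [||Dstar [Dse DsB]] := total_extension tphi (psi := psi) (M := B%:C).
- by rewrite lecR.
- move=> a.
  (* Duality: |psi a|^2 = <phi a, D (psi a)> <= |phi a| B |psi a|. *)
  have : `|lincomb psi a| ^+ 2 <= (B%:C * `|lincomb phi a|) * `|lincomb psi a|.
    have -> : `|lincomb psi a| ^+ 2 = `|inner (lincomb phi a) (D (lincomb psi a))|.
      rewrite -[LHS]ger0_norm ?exprn_ge0// -inner_norm; congr `|_|.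
      rewrite {1}/lincomb {1}[lincomb phi a]/lincomb !inner_suml.
      by apply: eq_bigr => p _; rewrite !innerZl mul_adj.
    rewrite (le_trans (CauchySchwarz_inner _ _))//.
    by rewrite mulrAC mulrC ler_wpM2r// ?mulrC.
  have [->|a0] := eqVneq (lincomb psi a) 0; first by rewrite normr0 mulr_ge0 ?lecR.
  by rewrite expr2 ler_pM2r// normr_gt0.
have Dsc : continuous Dstar by exact: bounded_linear_continuous DsB.
exists D, Dstar; split=> //.
- by split; [exact: linearP|exists B].
(* Conjugation moves [y] to the linear slot, where it can run over the total family of products of
   words. *)
- move=> x y; rewrite innerC [RHS]innerC; congr Num.conj.
  apply: (@inner_total_ext _ _ _ _ _ _ Dstar idfun _ _ tphi) => //.
    by move=> z; exact: cvg_id.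
  by move=> [s t]; rewrite Dse /psi /= innerC mul_adj -innerC.
- by move=> s t; exact: (Dse (s, t)).
Qed.

(** All components come from [degree_components]; the formula in each degree is checked against
    words through [comul_components]. *)
Lemma fock_mul_adjoint (Dstar : {linear FF -> F}) : continuous Dstar ->
  (forall s t, Dstar (elem s ⊠ elem t) = elem (s ++ t)) ->
  forall f g : F, fock_mul f g (Dstar (f ⊠ g)).
Proof.
move=> Dc De f g.
have Dv v : forall y, inner (elem v) (Dstar y) = inner (comul v) y.
  have tFF := total_boxt (HK := FF) total_elem total_elem.
  apply: (@inner_total_ext _ _ _ _ _ _ Dstar idfun _ _ tFF) => //.
    by move=> z; exact: cvg_id.
  by move=> [s t] /=; rewrite De inner_elem_cat.
have [P PP] := degree_components.
exists (P^~ f), (P^~ g), (P^~ (Dstar (f ⊠ g))); split=> // n.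
exists (fun k => Dstar (P k f ⊠ P (n - k)%N g)); split=> [k kn|].
  have homP m (x : F) : homogeneous m x ->
    exists2 a : nat -> formal_tensor H, forall j, homogeneous_formal m (a j) &
      fock_eval F (a j) @[j --> \oo] --> x.
    move=> /closure_seq[u uA ux].
    have /choice[a aP] j : exists a, homogeneous_formal m a /\ fock_eval F a = u j.
      by have [a am <-] := uA j; exists a.
    exists a => [j|]; first by case: (aP j).
    by rewrite (_ : (fun j => _) = u)//; apply/funext => j; case: (aP j).
  have [a ak ap] := homP k _ ((PP f).1 k).
  have [b bk bp] := homP (n - k)%N _ ((PP g).1 (n - k)%N).
  exists a, b; split => //.
  (* On formal tensors [Dstar] is the algebraic product, as pairing with words shows; continuity
     then gives the limit. *)
  have -> : (fun j => fock_eval F (formal_mul (a j) (b j))) =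
            (fun j => Dstar (fock_eval F (a j) ⊠ fock_eval F (b j))).
    apply/funext => j; apply: (inner_total_eq total_elem) => v.
    by rewrite inner_formal_mul Dv.
  by apply: continuous_cvg; [exact: Dc|exact: cvg_boxt].
apply: (inner_total_eq total_elem) => v.
rewrite [RHS]linear_sum /=; under [RHS]eq_bigr do rewrite Dv.
rewrite (comul_components _ _ (PP f) (PP g)).
case: eqP => [<-|/eqP vn]; last by rewrite (homogeneous_inner ((PP _).1 n)).
by rewrite -(has_components_inner _ (PP _)) Dv.
Qed.
End Fock.

Theorem proposition7 (R : realType) (H : hilbertType R) (w : nat -> R)
    (H_separable : separable_space H)
    (H_nonzero : exists x : H, x != 0)
    (w_gt0 : forall n, 0 < w n)
    (w_0 : w 0%N = 1)
    (w_summable : cvgn (series (fun n => ((w n)^-1) ^+ 2)))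
    (F : fullFock H w) (FF : hilbertTensor F F) :
  (exists! Delta : F -> FF,
     bounded_operator Delta /\
     exists Deltastar : FF -> F,
       is_adjoint Delta Deltastar /\
       forall f g : F, fock_mul f g (Deltastar (f ⊠ g)))
  <-> subconvolutive (fun n => ((w n) ^+ 2)^-1).
Proof.
split=> [[D [[Db [Dstar [adj mulP]]] _]]|].
  have [x x0] := H_nonzero; have [_ [M DM]] := Db.
  apply: (comul_bounded_subconvolutive w_gt0 (FF := FF) (M := M) x0) => s.
  by rewrite -(coproduct_elem w_gt0 s adj mulP).
move=> /(coproduct_exists w_gt0 FF)[D [Dstar [Db adj Dsc Dse]]].
have mulP := fock_mul_adjoint w_gt0 Dsc Dse.
exists D; split; first by split=> //; exists Dstar.
move=> D' [D'b [Dstar' [adj' mulP']]]; apply: coproduct_unique => // s.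
(* Both candidates are forced to equal [comul] on words. *)
by rewrite (coproduct_elem w_gt0 s adj mulP) (coproduct_elem w_gt0 s adj' mulP').
Qed.
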